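(* Let $k$ be a positive integer, let $\chi_k$ be an odd Dirichlet character modulo $k$ (or, more generally, any $k$-periodic odd sequence $\chi_k:\mathbb{Z}\to\mathbb{C}$, i.e. $\chi_k(n+k)=\chi_k(n)$ and $\chi_k(-n)=-\chi_k(n)$ for all $n$), and let $0<\beta<1$. Then \[ \prod_{n=1}^\infty\left(1-\frac{\beta^2}{n^2}\right)^{n\chi_k(n)}=\exp\left(-\frac{\pi}{k}\sum_{j=1}^{k-1}\chi_k(j)\int_0^\beta x\cot\frac{\pi(x+j)}{k}\,dx\right). \]
   Context: The infinite product is the limit of the partial products $\prod_{n=1}^N$ as $N\to\infty$. For a positive base $t$ and complex exponent $w$, $t^w=e^{w\ln t}$. *)

(* Defs.v *)
From Stdlib Require Import Reals ZArith.
From Coquelicot Require Import Coquelicot.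

Open Scope R_scope.

Definition cot (x : R) : R := cos x / sin x.

Definition Cexp (z : C) : C :=
  (exp (Re z) * cos (Im z), exp (Re z) * sin (Im z)).

(** [t ^ w = exp (w * ln t)]; meaningful only for [0 < t], since Stdlib's [ln]
    is [0] elsewhere. *)
Definition Rcpow (t : R) (w : C) : C := Cexp (w * RtoC (ln t))%C.

(** [Cprod f N] is the product of [f n] for [1 <= n <= N]. *)
Fixpoint Cprod (f : nat -> C) (N : nat) : C :=
  match N with
  | O => RtoC 1
  | S m => (Cprod f m * f (S m))%C
  end.

(** Only convergence of the partial products is required: unlike in some
    conventions for infinite products, a zero limit is not excluded. *)
Definition is_Cprod (f : nat -> C) (l : C) : Prop :=
  filterlim (Cprod f) eventually (locally l).

(* Main.v *)
Require Import Defs.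
From Stdlib Require Import Reals ZArith Lra Lia.
From Coquelicot Require Import Coquelicot.

Open Scope R_scope.

(** The exponents turn the product into an exponential, so the statement is about
    the series [sum chi(n) a(n)] with [a(n) = n ln (1 - beta^2/n^2)]; as [a(n)] is
    real, its real and imaginary parts can be treated separately
    ([is_lim_seq_sum_odd_ln], for a real odd periodic sequence).

    Put [A v t = v ln (1 + t/v) - t], the integral of [- s / (v + s)] over
    [0 <= s <= t]; then [a(n) = A n beta - A (-n) beta]. Group the partial sum
    over [n <= M k] by residues [j] modulo [k], with [n = k (m - 1) + j] and
    [1 <= m <= M], and replace [j] by [k - j] in the terms [A (-n) beta]: oddness
    absorbs the minus sign, and residue [j] contributes [chi j] times
    [sum_m (A (k (m - 1) + j) beta + A (j - k m) beta)]. The derivative of this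
    sum in [beta] is [- beta / k] times
    [sum_(m <= M) (1 / (y + m - 1) - 1 / (m - y))] with [y = (beta + j) / k],
    which is a partial sum of the partial fraction expansion of [PI cot (PI y)].
    If that expansion converges uniformly on [0 < y < 1] ([cot_part_unif]),
    integrating gives the limit for each residue ([is_lim_seq_sum_lnint]). Partial
    sums that stop inside a block have the same limit because [a(n)] tends to [0]
    ([is_lim_seq_sum_periodic]).

    For the uniform convergence, differentiate once more. The function
    [q y = PI^2 / sin^2 (PI y)] and the sums
    [p M y = sum_(m <= M) (1 / (y + m - 1)^2 + 1 / (m - y)^2)] obey the same
    duplication rule: [q y], respectively [p (2 M) y], is a quarter of the sum of
    the values of [q], respectively [p M], at [y / 2] and [(y + 1) / 2].
    So doubling [M] halves a uniform bound on [q - p M] over [0 < y < 1]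
    ([csc2_sub_part_pow2]), and the bound is finite for [M = 1] since [1 / sin^2]
    and the inverse square differ by at most [1] on half a period. Integrating back
    from [y = 1/2], where the cotangent and its partial sums all vanish, gives the
    expansion of the cotangent with a uniform error. *)

(** * Finite sums and limits of sequences *)

Lemma sum_1_S (f : nat -> R) (N : nat) :
  sum_n_m f 1 (S N) = sum_n_m f 1 N + f (S N).
Proof. rewrite sum_n_Sm; [reflexivity | lia]. Qed.

Lemma sum_1_0 (f : nat -> R) : sum_n_m f 1 0 = 0.
Proof. exact (sum_n_m_zero f 1 0 (le_n 1)). Qed.

Lemma sum_1_ext (f g : nat -> R) (N : nat) :
  (forall n, (1 <= n <= N)%nat -> f n = g n) -> sum_n_m f 1 N = sum_n_m g 1 N.
Proof. exact (sum_n_m_ext_loc f g 1 N). Qed.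

Lemma sum_1_plus (f g : nat -> R) (N : nat) :
  sum_n_m (fun n => f n + g n) 1 N = sum_n_m f 1 N + sum_n_m g 1 N.
Proof. exact (sum_n_m_plus f g 1 N). Qed.

Lemma sum_1_scal (c : R) (f : nat -> R) (N : nat) :
  sum_n_m (fun n => c * f n) 1 N = c * sum_n_m f 1 N.
Proof. exact (sum_n_m_mult_l (K := R_Ring) c f 1 N). Qed.

Lemma sum_1_opp (f : nat -> R) (N : nat) :
  sum_n_m (fun n => - f n) 1 N = - sum_n_m f 1 N.
Proof.
  rewrite (sum_1_ext _ (fun n => -1 * f n)) by (intros; apply Rminus_diag_uniq; ring).
  rewrite sum_1_scal; apply Rminus_diag_uniq; ring.
Qed.

Lemma sum_1_eq0 (f : nat -> R) (N : nat) :
  (forall n, (1 <= n <= N)%nat -> f n = 0) -> sum_n_m f 1 N = 0.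
Proof.
  intros H; rewrite (sum_1_ext f (fun n => 0 * f n)).
  - rewrite sum_1_scal; apply Rmult_0_l.
  - intros n Hn; rewrite (H n Hn); ring.
Qed.

Lemma sum_1_incr (f : nat -> R) (M N : nat) :
  (forall n, 0 <= f (S n)) -> (M <= N)%nat ->
  sum_n_m f 1 M <= sum_n_m f 1 N.
Proof.
  intros Hf; induction 1 as [|N HN IH]; [lra|].
  rewrite sum_1_S; specialize (Hf N); lra.
Qed.

Lemma sum_1_rev (f : nat -> R) (N : nat) :
  sum_n_m f 1 N = sum_n_m (fun j => f (S N - j)%nat) 1 N.
Proof.
  revert f; induction N as [|N IH]; intros f.
  - now rewrite !sum_1_0.
  - rewrite (sum_1_S (fun j => f (S (S N) - j)%nat)).
    replace (S (S N) - S N)%nat with 1%nat by lia.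
    rewrite (sum_Sn_m f 1 (S N)) by lia; rewrite <- sum_n_m_S, IH.
    etransitivity; [apply Rplus_comm | f_equal].
    apply sum_n_m_ext_loc; intros j Hj; f_equal; lia.
Qed.

Lemma sum_1_add (f : nat -> R) (a b : nat) :
  sum_n_m f 1 (a + b) = sum_n_m f 1 a + sum_n_m (fun i => f (a + i)%nat) 1 b.
Proof.
  induction b as [|b IH].
  - rewrite sum_1_0, Nat.add_0_r; symmetry; apply Rplus_0_r.
  - rewrite Nat.add_succ_r, !sum_1_S, IH, Nat.add_succ_r; apply Rplus_assoc.
Qed.

Lemma is_lim_seq_sum_1 (u : nat -> nat -> R) (l : nat -> R) (N : nat) :
  (forall j, (1 <= j <= N)%nat -> is_lim_seq (u j) (l j)) ->
  is_lim_seq (fun M => sum_n_m (fun j => u j M) 1 N) (sum_n_m l 1 N).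
Proof.
  induction N as [|N IH]; intros H.
  - apply is_lim_seq_ext with (fun _ => 0).
    + intros; now rewrite sum_1_0.
    + rewrite sum_1_0; apply is_lim_seq_const.
  - apply is_lim_seq_ext with (fun M => sum_n_m (fun j => u j M) 1 N + u (S N) M).
    + intros; now rewrite sum_1_S.
    + rewrite sum_1_S; apply is_lim_seq_plus'; [apply IH; intros; apply H; lia|apply H; lia].
Qed.

Lemma is_lim_seq_residues (u : nat -> R) (k : nat) (l : R) :
  (0 < k)%nat ->
  (forall r, (r < k)%nat -> is_lim_seq (fun M => u (M * k + r)%nat) l) ->
  is_lim_seq u l.
Proof.
  intros Hk H.
  assert (Hb : forall b, (b <= k)%nat -> forall P : R -> Prop, locally l P ->
    exists M0, forall M r, (M0 <= M)%nat -> (r < b)%nat -> P (u (M * k + r)%nat)).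
  { induction b as [|b IH]; intros Hbk P HP.
    - exists 0%nat; intros; lia.
    - destruct (IH ltac:(lia) P HP) as [M1 H1].
      destruct (H b ltac:(lia) P HP) as [M2 H2].
      exists (Nat.max M1 M2); intros M r HM Hr.
      destruct (Nat.eq_dec r b) as [->|]; [apply H2|apply H1]; lia. }
  intros P HP; destruct (Hb k (le_n _) P HP) as [M0 H0].
  exists (M0 * k)%nat; intros n Hn.
  rewrite (Nat.div_mod_eq n k), Nat.mul_comm.
  apply H0; [apply Nat.div_le_lower_bound; lia | apply Nat.mod_upper_bound; lia].
Qed.

(** * The partial fraction expansion of the cotangent *)

(** This is [z <= tan z] without the division: [sin z - z cos z] vanishes at [0] and
    has derivative [z sin z]. *)
Lemma mul_cos_le_sin (z : R) : 0 <= z <= PI / 2 -> z * cos z <= sin z.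
Proof.
  intros Hz.
  destruct (MVT_gen (fun z => sin z - z * cos z) 0 z (fun z => z * sin z)) as (c & Hc & E).
  - intros x _; auto_derive; [exact I | ring].
  - intros x _; apply derivable_continuous_pt; exists (x * sin x).
    apply is_derive_Reals; auto_derive; [exact I | ring].
  - rewrite Rmin_left, Rmax_right in Hc by lra.
    rewrite sin_0 in E.
    assert (0 <= sin c) by (apply sin_ge_0; lra).
    assert (0 <= c * sin c * (z - 0)) by (apply Rmult_le_pos; [apply Rmult_le_pos|]; lra).
    lra.
Qed.

(** The upper bound is [cot z <= 1 / z] squared, since [1 / sin^2 = 1 + cot^2]. *)
Lemma inv_sqr_sin_bounds (z : R) :
  0 < z <= PI / 2 -> / z ^ 2 <= / sin z ^ 2 <= / z ^ 2 + 1.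
Proof.
  intros Hz.
  assert (Hs : 0 < sin z) by (apply sin_gt_0; lra).
  assert (Hs' : sin z <= z) by (left; apply sin_lt_x; lra).
  split.
  - apply Rinv_le_contravar; [apply pow_lt; lra | apply pow_incr; lra].
  - assert (Hc : 0 <= cos z) by (apply cos_ge_0; lra).
    assert (H := mul_cos_le_sin z ltac:(lra)).
    assert (H2 : (z * cos z) ^ 2 <= sin z ^ 2)
      by (apply pow_incr; split; [apply Rmult_le_pos; lra | lra]).
    assert (Hcs := sin2_cos2 z); unfold Rsqr in Hcs.
    apply Rmult_le_reg_r with (z ^ 2 * sin z ^ 2);
      [apply Rmult_lt_0_compat; apply pow_lt; lra|].
    replace (/ sin z ^ 2 * (z ^ 2 * sin z ^ 2)) with (z ^ 2) by (field; lra).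
    replace ((/ z ^ 2 + 1) * (z ^ 2 * sin z ^ 2)) with (sin z ^ 2 + z ^ 2 * sin z ^ 2)
      by (field; lra).
    replace (z ^ 2) with (z ^ 2 * (sin z * sin z + cos z * cos z)) at 1
      by (rewrite Hcs; ring).
    lra.
Qed.

Definition csc2 (y : R) : R := PI ^ 2 / sin (PI * y) ^ 2.

(** The [m]-th term pairs the poles [1 - m] and [m]. With this pairing the partial
    sums are symmetric under [y -> 1 - y] and obey an exact duplication rule. *)
Definition csc2_part (M : nat) (y : R) : R :=
  sum_n_m (fun m => / (y + (INR m - 1)) ^ 2 + / (INR m - y) ^ 2) 1 M.

(** An antiderivative of [- csc2_part M], antisymmetric under [y -> 1 - y]. *)
Definition cot_part (M : nat) (y : R) : R :=
  sum_n_m (fun m => / (y + (INR m - 1)) - / (INR m - y)) 1 M.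

Lemma sin_PI_pos (y : R) : 0 < y < 1 -> 0 < sin (PI * y).
Proof.
  intros Hy; assert (HPI := PI_RGT_0).
  apply sin_gt_0; nra.
Qed.

Lemma csc2_part_S (M : nat) (y : R) :
  csc2_part (S M) y = csc2_part M y + (/ (y + INR M) ^ 2 + / (INR M + 1 - y) ^ 2).
Proof.
  unfold csc2_part; rewrite sum_1_S, S_INR.
  now replace (INR M + 1 - 1) with (INR M) by ring.
Qed.

Lemma cot_part_S (M : nat) (y : R) :
  cot_part (S M) y = cot_part M y + (/ (y + INR M) - / (INR M + 1 - y)).
Proof.
  unfold cot_part; rewrite sum_1_S, S_INR.
  now replace (INR M + 1 - 1) with (INR M) by ring.
Qed.

(** With [s] and [c] the sine and cosine of [PI y / 2], this is
    [1 / s^2 + 1 / c^2 = 1 / (s c)^2 = 4 / sin^2 (PI y)]. *)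
Lemma csc2_dup (y : R) :
  0 < y < 1 -> csc2 y = / 4 * (csc2 (y / 2) + csc2 ((y + 1) / 2)).
Proof.
  intros Hy; unfold csc2.
  assert (H1 := sin_PI_pos (y / 2) ltac:(lra)).
  assert (H2 := sin_PI_pos ((y + 1) / 2) ltac:(lra)).
  replace (PI * ((y + 1) / 2)) with (PI / 2 + PI * (y / 2)) in * by field.
  rewrite <- cos_sin in *.
  replace (PI * y) with (2 * (PI * (y / 2))) by field.
  rewrite sin_2a.
  assert (Hcs := sin2_cos2 (PI * (y / 2))); unfold Rsqr in Hcs.
  set (s := sin (PI * (y / 2))) in *; set (c := cos (PI * (y / 2))) in *.
  replace (PI ^ 2 / s ^ 2 + PI ^ 2 / c ^ 2)
    with (PI ^ 2 * (s * s + c * c) / (s ^ 2 * c ^ 2)) by (field; lra).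
  rewrite Hcs; field; lra.
Qed.

(** Substituting [y / 2] yields four times the terms of the even shifts of [y], and
    [(y + 1) / 2] those of the odd shifts. *)
Lemma csc2_part_dup (M : nat) (y : R) :
  0 < y < 1 ->
  csc2_part (2 * M) y = / 4 * (csc2_part M (y / 2) + csc2_part M ((y + 1) / 2)).
Proof.
  intros Hy; induction M as [|M IH].
  - unfold csc2_part; simpl Nat.mul; rewrite !sum_1_0; lra.
  - replace (2 * S M)%nat with (S (S (2 * M))) by lia.
    rewrite !csc2_part_S, IH, S_INR, mult_INR; simpl (INR 2).
    assert (HM := pos_INR M).
    field; lra.
Qed.

(** By symmetry [y <= 1/2] may be assumed. Then [csc2 y - 1 / y^2] lies between [0]
    and [PI^2 <= 16], and the term of the other pole is at most [4]. *)
Lemma csc2_sub_part_1 (y : R) :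
  0 < y < 1 -> Rabs (csc2 y - csc2_part 1 y) <= 16.
Proof.
  assert (HPI := PI_RGT_0); assert (HPI4 := PI_4).
  assert (Hhalf : forall y, 0 < y <= 1 / 2 -> Rabs (csc2 y - csc2_part 1 y) <= 16).
  { clear y; intros y Hy; rewrite csc2_part_S; unfold csc2_part, csc2; rewrite sum_1_0.
    simpl (INR 0).
    destruct (inv_sqr_sin_bounds (PI * y)) as [H1 H2]; [split; nra|].
    assert (E : PI ^ 2 * / (PI * y) ^ 2 = / y ^ 2) by (field; lra).
    assert (H3 : 0 < / (0 + 1 - y) ^ 2 <= 4).
    { split; [apply Rinv_0_lt_compat, pow_lt; lra|].
      replace 4 with (/ (1 / 2) ^ 2) by field.
      apply Rinv_le_contravar; [nra | apply pow_incr; lra]. }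
    assert (Hp : 0 < PI ^ 2 <= 16) by nra.
    assert (H1' := Rmult_le_compat_l (PI ^ 2) _ _ ltac:(lra) H1).
    assert (H2' := Rmult_le_compat_l (PI ^ 2) _ _ ltac:(lra) H2).
    unfold Rdiv; rewrite Rplus_0_r; apply Rabs_le; lra. }
  intros Hy; destruct (Rle_dec y (1 / 2)) as [H|H]; [apply Hhalf; lra|].
  replace (csc2 y - csc2_part 1 y) with (csc2 (1 - y) - csc2_part 1 (1 - y)).
  - apply Hhalf; lra.
  - unfold csc2; replace (PI * (1 - y)) with (PI - PI * y) by ring.
    rewrite sin_PI_x, !csc2_part_S; unfold csc2_part; rewrite !sum_1_0; simpl (INR 0).
    field; assert (Hs := sin_PI_pos y Hy); lra.
Qed.

(** The two duplication rules average the error at two points with total weight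
    [1/2], so each doubling of the number of terms halves it. *)
Lemma csc2_sub_part_pow2 (m : nat) (y : R) :
  0 < y < 1 -> Rabs (csc2 y - csc2_part (2 ^ m) y) <= 16 / 2 ^ m.
Proof.
  revert y; induction m as [|m IH]; intros y Hy.
  - simpl (2 ^ 0)%nat; simpl (2 ^ 0); rewrite Rdiv_1_r; now apply csc2_sub_part_1.
  - rewrite Nat.pow_succ_r', csc2_part_dup, csc2_dup by easy.
    assert (H1 := IH (y / 2) ltac:(lra)).
    assert (H2 := IH ((y + 1) / 2) ltac:(lra)).
    apply Rabs_le_between in H1; apply Rabs_le_between in H2.
    replace (16 / 2 ^ S m) with (/ 2 * (16 / 2 ^ m))
      by (simpl pow; field; apply pow_nonzero; lra).
    apply Rabs_le; lra.
Qed.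

(** The partial sums increase with [M], hence lie between those at two powers of
    [2], namely [2 ^ m] and the larger power [2 ^ M]. *)
Lemma csc2_sub_part_le (m M : nat) (y : R) :
  (2 ^ m <= M)%nat -> 0 < y < 1 -> Rabs (csc2 y - csc2_part M y) <= 16 / 2 ^ m.
Proof.
  intros HM Hy.
  assert (Hmono : forall a b, (a <= b)%nat -> csc2_part a y <= csc2_part b y).
  { intros a b; apply sum_1_incr; intros n; rewrite S_INR; assert (Hn := pos_INR n).
    apply Rplus_le_le_0_compat; left; apply Rinv_0_lt_compat, pow_lt; lra. }
  assert (H2 : (M < 2 ^ M)%nat) by (apply Nat.pow_gt_lin_r; lia).
  assert (Hm : (m < 2 ^ m)%nat) by (apply Nat.pow_gt_lin_r; lia).
  assert (Ha := csc2_sub_part_pow2 m y Hy); apply Rabs_le_between in Ha.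
  assert (Hb := csc2_sub_part_pow2 M y Hy); apply Rabs_le_between in Hb.
  assert (H3 := Hmono _ _ HM); assert (H4 := Hmono M (2 ^ M)%nat ltac:(lia)).
  assert (H5 : 16 / 2 ^ M <= 16 / 2 ^ m).
  { apply Rmult_le_compat_l; [lra|].
    apply Rinv_le_contravar; [apply pow_lt; lra | apply Rle_pow; [lra|lia]]. }
  apply Rabs_le; lra.
Qed.

Lemma is_derive_cot_part (M : nat) (y : R) :
  0 < y < 1 -> is_derive (cot_part M) y (- csc2_part M y).
Proof.
  intros Hy; induction M as [|M IH].
  - apply is_derive_ext with (fun _ => 0).
    + intros t; unfold cot_part; now rewrite sum_1_0.
    + unfold csc2_part; rewrite sum_1_0, Ropp_0; auto_derive; [exact I | reflexivity].
  - apply is_derive_ext with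
      (fun y => cot_part M y + (/ (y + INR M) - / (INR M + 1 - y))).
    + intros t; now rewrite cot_part_S.
    + rewrite csc2_part_S, Ropp_plus_distr.
      apply @is_derive_plus; [exact IH|].
      assert (HM := pos_INR M).
      auto_derive; [lra | field; lra].
Qed.

Lemma is_derive_PI_cot (y : R) :
  0 < y < 1 -> is_derive (fun y => PI * cot (PI * y)) y (- csc2 y).
Proof.
  intros Hy; assert (Hs := sin_PI_pos y Hy); unfold cot, csc2.
  auto_derive; [lra|].
  assert (Hcs := sin2_cos2 (PI * y)); unfold Rsqr in Hcs.
  set (s := sin (PI * y)) in *; set (c := cos (PI * y)) in *.
  replace (PI ^ 2 / s ^ 2) with (PI ^ 2 * (s * s + c * c) / s ^ 2) by (rewrite Hcs; field; lra).
  field; lra.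
Qed.

(** Both functions vanish at [1/2], and the difference of their derivatives is
    bounded by [csc2_sub_part_le]. *)
Lemma cot_sub_part_le (m M : nat) (y : R) :
  (2 ^ m <= M)%nat -> 0 < y < 1 ->
  Rabs (PI * cot (PI * y) - cot_part M y) <= 16 / 2 ^ m.
Proof.
  intros HM Hy.
  set (d := fun y => PI * cot (PI * y) - cot_part M y).
  assert (Hd : forall x, 0 < x < 1 -> is_derive d x (- (csc2 x - csc2_part M x))).
  { intros x Hx; replace (- (csc2 x - csc2_part M x)) with
      (minus (- csc2 x) (- csc2_part M x)) by (unfold minus, plus, opp; simpl; ring).
    apply @is_derive_minus; [now apply is_derive_PI_cot | now apply is_derive_cot_part]. }
  assert (H0 : d (1 / 2) = 0).
  { unfold d, cot; replace (PI * (1 / 2)) with (PI / 2) by field; rewrite cos_PI2.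
    assert (E : cot_part M (1 / 2) = 0).
    { clear; induction M as [|M IH]; [apply sum_1_0|].
      rewrite cot_part_S, IH; replace (INR M + 1 - 1 / 2) with (1 / 2 + INR M) by field; ring. }
    rewrite E; unfold Rdiv; ring. }
  assert (Hseg : forall x, Rmin (1 / 2) y <= x <= Rmax (1 / 2) y -> 0 < x < 1).
  { intros x; unfold Rmin, Rmax; destruct (Rle_dec (1 / 2) y); lra. }
  destruct (MVT_gen d (1 / 2) y (fun x => - (csc2 x - csc2_part M x))) as (c & Hc & E).
  - intros x Hx; apply Hd, Hseg; lra.
  - intros x Hx; apply derivable_continuous_pt; eexists; apply is_derive_Reals, Hd, Hseg; lra.
  - change (Rabs (d y) <= 16 / 2 ^ m).
    replace (d y) with (d y - d (1 / 2)) by (rewrite H0; ring).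
    rewrite E, Rabs_mult, Rabs_Ropp.
    assert (Hq := csc2_sub_part_le m M c HM (Hseg c Hc)).
    assert (Hy2 : Rabs (y - 1 / 2) <= 1) by (apply Rabs_le; lra).
    assert (P1 := Rabs_pos (csc2 c - csc2_part M c)).
    assert (P2 := Rabs_pos (y - 1 / 2)).
    nra.
Qed.

Lemma cot_part_unif (eps : R) :
  0 < eps -> exists M0, forall M y, (M0 <= M)%nat -> 0 < y < 1 ->
    Rabs (PI * cot (PI * y) - cot_part M y) <= eps.
Proof.
  intros He.
  assert (Hl : is_lim_seq (fun m => 16 * (/ 2) ^ m) (16 * 0)).
  { apply is_lim_seq_mult'; [apply is_lim_seq_const|].
    apply is_lim_seq_geom; rewrite Rabs_right; lra. }
  rewrite Rmult_0_r in Hl; apply is_lim_seq_spec in Hl.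
  destruct (Hl (mkposreal _ He)) as [m Hm]; specialize (Hm m (le_n _)).
  exists (2 ^ m)%nat; intros M y HM Hy.
  apply Rle_trans with (16 / 2 ^ m); [now apply cot_sub_part_le|].
  simpl in Hm; rewrite pow_inv, Rminus_0_r in Hm.
  apply Rabs_lt_between in Hm; unfold Rdiv; lra.
Qed.

(** * Sums against an odd periodic sequence *)

Lemma periodic_mul (k : nat) (chi : Z -> R) (M i : nat) :
  (forall n : Z, chi (n + Z.of_nat k)%Z = chi n) ->
  chi (Z.of_nat (M * k + i)) = chi (Z.of_nat i).
Proof.
  intros chi_per; induction M as [|M IH]; [reflexivity|].
  rewrite <- IH, <- (chi_per (Z.of_nat (M * k + i))); f_equal; lia.
Qed.

Lemma odd_at_0 (chi : Z -> R) :
  (forall n : Z, chi (- n)%Z = - chi n) ->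
  chi 0%Z = 0.
Proof. intros chi_odd; assert (H := chi_odd 0%Z); simpl in H; lra. Qed.

(** The residue [0] modulo [k] drops out because [chi] vanishes there. *)
Lemma sum_periodic_blocks (k : nat) (chi : Z -> R) (f : nat -> R) (M : nat) :
  (0 < k)%nat ->
  (forall n : Z, chi (n + Z.of_nat k)%Z = chi n) ->
  chi 0%Z = 0 ->
  sum_n_m (fun n => chi (Z.of_nat n) * f n) 1 (M * k) =
  sum_n_m (fun j => chi (Z.of_nat j) *
                    sum_n_m (fun m => f ((m - 1) * k + j)%nat) 1 M) 1 (k - 1).
Proof.
  intros k_gt0 chi_per chi0; induction M as [|M IH].
  - simpl Nat.mul; rewrite sum_1_0; symmetry.
    apply sum_1_eq0; intros j _; rewrite sum_1_0; ring.
  - replace (S M * k)%nat with (M * k + S (k - 1))%nat by lia.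
    rewrite sum_1_add, sum_1_S, IH.
    replace (M * k + S (k - 1))%nat with (S M * k + 0)%nat by lia.
    rewrite periodic_mul by exact chi_per; simpl (Z.of_nat 0); rewrite chi0, Rmult_0_l, Rplus_0_r.
    rewrite <- sum_1_plus; apply sum_1_ext; intros j _.
    rewrite periodic_mul, sum_1_S by exact chi_per.
    replace (S M - 1)%nat with M by lia; ring.
Qed.

Lemma sum_odd_reflect (k : nat) (chi : Z -> R) (g : nat -> R) :
  (forall n : Z, chi (n + Z.of_nat k)%Z = chi n) ->
  (forall n : Z, chi (- n)%Z = - chi n) ->
  sum_n_m (fun j => chi (Z.of_nat j) * g j) 1 (k - 1) =
  - sum_n_m (fun j => chi (Z.of_nat j) * g (k - j)%nat) 1 (k - 1).
Proof.
  intros chi_per chi_odd.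
  rewrite sum_1_rev, <- sum_1_opp.
  apply sum_1_ext; intros j Hj.
  replace (S (k - 1) - j)%nat with (k - j)%nat by lia.
  replace (Z.of_nat (k - j)) with (- Z.of_nat j + Z.of_nat k)%Z by lia.
  rewrite chi_per, chi_odd; ring.
Qed.

(** Beyond the last complete block there are fewer than [k] terms, each of the form
    [chi i * f (M k + i)] with [i] fixed. *)
Lemma is_lim_seq_sum_periodic (k : nat) (chi : Z -> R) (f : nat -> R) (l : R) :
  (0 < k)%nat ->
  (forall n : Z, chi (n + Z.of_nat k)%Z = chi n) ->
  is_lim_seq f 0 ->
  is_lim_seq (fun M => sum_n_m (fun n => chi (Z.of_nat n) * f n) 1 (M * k)) l ->
  is_lim_seq (fun N => sum_n_m (fun n => chi (Z.of_nat n) * f n) 1 N) l.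
Proof.
  intros k_gt0 chi_per Hf Hl; apply is_lim_seq_residues with k; [exact k_gt0|]; intros r _.
  apply is_lim_seq_ext with (fun M =>
    sum_n_m (fun n => chi (Z.of_nat n) * f n) 1 (M * k) +
    sum_n_m (fun i => chi (Z.of_nat i) * f (M * k + i)%nat) 1 r).
  - intros M; rewrite sum_1_add; f_equal.
    apply sum_1_ext; intros i _; now rewrite periodic_mul.
  - replace l with (l + sum_n_m (fun i => chi (Z.of_nat i) * 0) 1 r).
    + apply is_lim_seq_plus'; [exact Hl|].
      apply (is_lim_seq_sum_1 (fun i M => chi (Z.of_nat i) * f (M * k + i)%nat)).
      intros i _; apply is_lim_seq_mult'; [apply is_lim_seq_const|].
      apply (is_lim_seq_subseq f 0 (fun M => (M * k + i)%nat)); [|exact Hf].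
      apply eventually_subseq; intros n; nia.
    + rewrite sum_1_eq0 by (intros; ring); ring.
Qed.

(** * The logarithms of the factors *)

(** For [0 < 1 + t / v] this is the integral of [- s / (v + s)] for [s] from [0] to
    [t]. Allowing negative [v] treats the two factors [1 + t / n] and [1 - t / n]
    alike. *)
Definition lnint (v t : R) : R := v * ln (1 + t / v) - t.

Lemma lnint_0 (v : R) : lnint v 0 = 0.
Proof. unfold lnint, Rdiv; rewrite Rmult_0_l, Rplus_0_r, ln_1; ring. Qed.

Lemma is_derive_lnint (v t : R) :
  0 < 1 + t / v -> v <> 0 -> is_derive (lnint v) t (- t / (v + t)).
Proof.
  intros H Hv; unfold lnint.
  assert (v + t <> 0).
  { intros E; replace t with (- v) in H by lra.
    replace (1 + - v / v) with 0 in H by (field; lra); lra. }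
  auto_derive; [now repeat split | field].
  split; lra.
Qed.

Lemma lnint_sub_opp (n b : R) :
  0 < b < 1 -> 1 <= n -> n * ln (1 - b ^ 2 / n ^ 2) = lnint n b - lnint (- n) b.
Proof.
  intros Hb Hn; unfold lnint.
  assert (H : 0 < b / n < 1).
  { split; [apply Rdiv_lt_0_compat; lra|].
    apply Rmult_lt_reg_r with n; [lra|]; field_simplify; lra. }
  replace (b / - n) with (- (b / n)) by (field; lra).
  replace (1 - b ^ 2 / n ^ 2) with ((1 + b / n) * (1 + - (b / n))) by (field; lra).
  rewrite ln_mult by lra; ring.
Qed.

(** Since [- s / (1 - s) <= ln (1 - s) <= 0], the term is at most
    [b^2 / (1 - b^2) / n] in absolute value. *)
Lemma is_lim_seq_mul_ln (b : R) :
  0 < b < 1 -> is_lim_seq (fun n => INR n * ln (1 - b ^ 2 / INR n ^ 2)) 0.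
Proof.
  intros Hb; set (c := b ^ 2 / (1 - b ^ 2)).
  assert (Hb2 : 0 < 1 - b ^ 2) by nra.
  assert (Hl : is_lim_seq (fun n => - c * / INR (S n)) 0).
  { replace 0 with (- c * 0) by ring.
    apply is_lim_seq_mult'; [apply is_lim_seq_const|].
    apply is_lim_seq_incr_1 with (u := fun n => / INR n).
    replace (Finite 0) with (Rbar_inv p_infty) by reflexivity.
    apply is_lim_seq_inv; [apply is_lim_seq_INR | discriminate]. }
  apply is_lim_seq_incr_1.
  apply is_lim_seq_le_le with (fun n => - c * / INR (S n)) (fun _ => 0);
    [|exact Hl|apply is_lim_seq_const].
  intros n; set (x := INR (S n)).
  assert (Hx : 1 <= x) by (unfold x; rewrite S_INR; assert (H := pos_INR n); lra).
  set (s := b ^ 2 / x ^ 2).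
  assert (Hs : 0 < s <= b ^ 2).
  { split; [apply Rdiv_lt_0_compat; nra|].
    apply Rmult_le_reg_r with (x ^ 2); [nra|].
    unfold s; replace (b ^ 2 / x ^ 2 * x ^ 2) with (b ^ 2) by (field; lra).
    assert (1 <= x ^ 2) by nra; nra. }
  assert (H1 : ln (1 - s) <= 0).
  { rewrite <- ln_1; apply ln_le; lra. }
  (* [ln u <= u - 1] at [u = 1 / (1 - s)]. *)
  assert (H2 : - (s / (1 - s)) <= ln (1 - s)).
  { assert (H : ln (/ (1 - s)) <= / (1 - s) - 1).
    { rewrite <- (ln_exp (/ (1 - s) - 1)); apply ln_le; [apply Rinv_0_lt_compat; lra|].
      assert (E := exp_ineq1_le (/ (1 - s) - 1)); lra. }
    rewrite ln_Rinv in H by lra.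
    replace (s / (1 - s)) with (/ (1 - s) - 1) by (field; lra); lra. }
  assert (H3 : s / (1 - s) <= s / (1 - b ^ 2)).
  { apply Rmult_le_compat_l; [lra|]; apply Rinv_le_contravar; lra. }
  assert (E : - c * / x = x * - (s / (1 - b ^ 2))).
  { unfold c, s; field; lra. }
  split; [rewrite E; apply Rmult_le_compat_l; lra | nra].
Qed.

(** The sum vanishes for [b = 0], so it is the integral of its derivative in [b],
    [- (t / k) cot_part M ((t + j) / k)], which converges uniformly. *)
Lemma is_lim_seq_sum_lnint (k j : nat) (b : R) :
  (1 <= j < k)%nat -> 0 < b < 1 ->
  is_lim_seq
    (fun M => sum_n_m (fun m => lnint (INR k * (INR m - 1) + INR j) b
                              + lnint (INR j - INR k * INR m) b) 1 M)
    (- (PI / INR k) * RInt (fun x => x * cot (PI * (x + INR j) / INR k)) 0 b).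
Proof.
  intros Hj Hb.
  assert (Hj1 : 1 <= INR j) by (apply (le_INR 1); lia).
  assert (Hjk : INR j + 1 <= INR k) by (rewrite <- S_INR; apply le_INR; lia).
  set (g := fun x => x * cot (PI * (x + INR j) / INR k)).
  set (Phi := fun M t => sum_n_m (fun m => lnint (INR k * (INR m - 1) + INR j) t
                              + lnint (INR j - INR k * INR m) t) 1 M).
  set (dPhi := fun M t => - (t / INR k) * cot_part M ((t + INR j) / INR k)).
  assert (Hy : forall t, 0 <= t <= b -> 0 < (t + INR j) / INR k < 1).
  { intros t Ht; split; [apply Rdiv_lt_0_compat; lra|].
    apply Rmult_lt_reg_r with (INR k); [lra|]; field_simplify; lra. }
  assert (HPhi : forall M t, 0 <= t <= b -> is_derive (Phi M) t (dPhi M t)).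
  { intros M t Ht; induction M as [|M IH].
    - apply is_derive_ext with (fun _ => 0).
      + intros s; unfold Phi; now rewrite sum_1_0.
      + unfold dPhi, cot_part; rewrite sum_1_0, Rmult_0_r.
        auto_derive; [exact I | reflexivity].
    - apply is_derive_ext with
        (fun t => Phi M t + (lnint (INR k * INR M + INR j) t
                             + lnint (INR j - INR k * (INR M + 1)) t)).
      + intros s; unfold Phi; rewrite sum_1_S, S_INR.
        now replace (INR M + 1 - 1) with (INR M) by ring.
      + assert (HM := pos_INR M).
        assert (HkM : 0 <= INR k * INR M) by (apply Rmult_le_pos; lra).
        assert (Hv : 0 < INR k * INR M + INR j) by lra.
        assert (Hw : INR j - INR k * (INR M + 1) <= -1) by lra.
        set (v := INR k * INR M + INR j) in *.
        set (w := INR j - INR k * (INR M + 1)) in *.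
        replace (dPhi (S M) t) with (dPhi M t + (- t / (v + t) + - t / (w + t))).
        * apply @is_derive_plus; [exact IH|].
          apply @is_derive_plus; apply is_derive_lnint.
          -- assert (0 <= t / v) by (apply Rmult_le_pos; [lra | left; now apply Rinv_0_lt_compat]).
             lra.
          -- lra.
          -- replace (1 + t / w) with ((- w - t) / - w) by (field; lra).
             apply Rdiv_lt_0_compat; lra.
          -- lra.
        * unfold dPhi; rewrite cot_part_S; unfold v, w in *.
          field; repeat split; nra. }
  assert (HdPhi : forall M t, 0 <= t <= b -> continuous (dPhi M) t).
  { intros M t Ht; apply @ex_derive_continuous; unfold dPhi; auto_derive.
    eexists; now apply is_derive_cot_part, Hy. }
  assert (Hg : forall t, 0 <= t <= b -> continuous g t).
  { intros t Ht; apply @ex_derive_continuous; unfold g, cot; auto_derive.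
    assert (Hs := sin_PI_pos _ (Hy t Ht)).
    replace (PI * ((t + INR j) / INR k)) with (PI * (t + INR j) / INR k) in Hs
      by (field; lra).
    unfold Rdiv in Hs; lra. }
  assert (Ig : is_RInt g 0 b (RInt g 0 b)).
  { apply (RInt_correct g), (ex_RInt_continuous g); intros t.
    rewrite Rmin_left, Rmax_right by lra; apply Hg. }
  assert (Id : forall M, is_RInt (dPhi M) 0 b (Phi M b)).
  { intros M.
    replace (Phi M b) with (minus (Phi M b) (Phi M 0)).
    - apply (is_RInt_derive (Phi M) (dPhi M)); intros t;
        rewrite Rmin_left, Rmax_right by lra; [apply HPhi | apply HdPhi].
    - replace (Phi M 0) with 0; [unfold minus, plus, opp; simpl; ring|].
      symmetry; apply sum_1_eq0; intros m _; rewrite !lnint_0; ring. }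
  apply is_lim_seq_spec; intros eps.
  destruct (cot_part_unif (eps / 2) ltac:(destruct eps; simpl; lra)) as [M0 HM0].
  exists M0; intros M HM.
  change (Rabs (Phi M b - - (PI / INR k) * RInt g 0 b) < eps).
  assert (I := is_RInt_minus _ _ _ _ _ _ (Id M) (is_RInt_scal g 0 b (- (PI / INR k)) _ Ig)).
  assert (E : RInt (fun t => minus (dPhi M t) (scal (- (PI / INR k)) (g t))) 0 b
              = Phi M b - - (PI / INR k) * RInt g 0 b) by exact (is_RInt_unique _ _ _ _ I).
  rewrite <- E.
  apply Rle_lt_trans with ((b - 0) * (eps / 2)); [|destruct eps; simpl; nra].
  apply abs_RInt_le_const; [lra | eexists; exact I|].
  intros t Ht.
  unfold minus, plus, opp, scal; simpl; unfold mult; simpl; unfold dPhi, g.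
  replace (PI * (t + INR j) / INR k) with (PI * ((t + INR j) / INR k)) by (field; lra).
  set (y := (t + INR j) / INR k).
  replace (- (t / INR k) * cot_part M y + - (- (PI / INR k) * (t * cot (PI * y))))
    with (t / INR k * (PI * cot (PI * y) - cot_part M y)) by (field; lra).
  assert (Hc := HM0 M y HM (Hy t Ht)).
  assert (Htk : 0 <= t / INR k <= 1).
  { split; [apply Rmult_le_pos; [lra | left; apply Rinv_0_lt_compat; lra]|].
    apply Rmult_le_reg_r with (INR k); [lra|]; field_simplify; lra. }
  rewrite Rabs_mult, (Rabs_right (t / INR k)) by lra.
  assert (Hp := Rabs_pos (PI * cot (PI * y) - cot_part M y)); nra.
Qed.

(** Reflecting [j] to [k - j] in the terms with negative first argument turns the
    poles [- (k (m - 1) + j)] into [j - k m], which completes the two-sided sum of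
    [is_lim_seq_sum_lnint]. *)
Lemma is_lim_seq_sum_odd_ln (k : nat) (chi : Z -> R) (b : R) :
  (0 < k)%nat ->
  (forall n : Z, chi (n + Z.of_nat k)%Z = chi n) ->
  (forall n : Z, chi (- n)%Z = - chi n) ->
  0 < b < 1 ->
  is_lim_seq
    (fun N => sum_n_m (fun n => chi (Z.of_nat n)
                                * (INR n * ln (1 - b ^ 2 / INR n ^ 2))) 1 N)
    (- (PI / INR k) *
     sum_n_m (fun j => chi (Z.of_nat j) *
                       RInt (fun x => x * cot (PI * (x + INR j) / INR k)) 0 b)
       1 (k - 1)).
Proof.
  intros Hk Hper Hodd Hb.
  apply (is_lim_seq_sum_periodic k); [exact Hk | exact Hper | now apply is_lim_seq_mul_ln|].
  apply is_lim_seq_ext with (fun M =>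
    sum_n_m (fun j => chi (Z.of_nat j) *
       sum_n_m (fun m => lnint (INR k * (INR m - 1) + INR j) b
                         + lnint (INR j - INR k * INR m) b) 1 M) 1 (k - 1)).
  - intros M; rewrite (sum_periodic_blocks k chi _ M Hk Hper (odd_at_0 chi Hodd)).
    (* [gam j] collects the terms [lnint (- n) b] with [n] congruent to [j]. *)
    set (gam := fun j => sum_n_m (fun m => lnint (- (INR k * (INR m - 1) + INR j)) b) 1 M).
    transitivity
      (sum_n_m (fun j => chi (Z.of_nat j) *
         sum_n_m (fun m => lnint (INR k * (INR m - 1) + INR j) b) 1 M) 1 (k - 1)
       + - sum_n_m (fun j => chi (Z.of_nat j) * gam j) 1 (k - 1)).
    + rewrite (sum_odd_reflect k chi gam Hper Hodd), Ropp_involutive, <- sum_1_plus.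
      apply sum_1_ext; intros j Hj.
      rewrite <- Rmult_plus_distr_l; f_equal; unfold gam.
      rewrite <- sum_1_plus; apply sum_1_ext; intros m _.
      rewrite minus_INR by lia; do 2 f_equal; ring.
    + rewrite <- sum_1_opp, <- sum_1_plus; apply sum_1_ext; intros j Hj; unfold gam.
      transitivity (chi (Z.of_nat j) *
        (sum_n_m (fun m => lnint (INR k * (INR m - 1) + INR j) b) 1 M
         + - sum_n_m (fun m => lnint (- (INR k * (INR m - 1) + INR j)) b) 1 M)); [ring|].
      rewrite <- sum_1_opp, <- sum_1_plus; f_equal.
      apply sum_1_ext; intros m Hm.
      assert (E : INR ((m - 1) * k + j) = INR k * (INR m - 1) + INR j).
      { rewrite plus_INR, mult_INR, minus_INR by lia; simpl (INR 1); ring. }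
      rewrite E, lnint_sub_opp; [ring | exact Hb | rewrite <- E].
      apply (le_INR 1); nia.
  - rewrite <- sum_1_scal.
    rewrite (sum_1_ext _ (fun j => chi (Z.of_nat j) * (- (PI / INR k) *
       RInt (fun x => x * cot (PI * (x + INR j) / INR k)) 0 b))) by (intros; ring).
    apply (is_lim_seq_sum_1 (fun j M => chi (Z.of_nat j) *
       sum_n_m (fun m => lnint (INR k * (INR m - 1) + INR j) b
                         + lnint (INR j - INR k * INR m) b) 1 M)).
    intros j Hj; apply is_lim_seq_mult'; [apply is_lim_seq_const|].
    apply is_lim_seq_sum_lnint; [lia | exact Hb].
Qed.

(** * Back to complex products *)

Lemma Cexp_plus (z w : C) : Cexp (z + w)%C = (Cexp z * Cexp w)%C.
Proof.
  destruct z as [a b], w as [c d]; unfold Cexp, Cplus, Cmult; simpl.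
  rewrite exp_plus, cos_plus, sin_plus; f_equal; ring.
Qed.

Lemma Re_sum_1 (f : nat -> C) (N : nat) :
  Re (sum_n_m f 1 N) = sum_n_m (fun n => Re (f n)) 1 N.
Proof.
  induction N as [|N IH]; [reflexivity|].
  rewrite sum_1_S, <- IH, sum_n_Sm by lia; reflexivity.
Qed.

Lemma Im_sum_1 (f : nat -> C) (N : nat) :
  Im (sum_n_m f 1 N) = sum_n_m (fun n => Im (f n)) 1 N.
Proof.
  induction N as [|N IH]; [reflexivity|].
  rewrite sum_1_S, <- IH, sum_n_Sm by lia; reflexivity.
Qed.

Lemma Cprod_Rcpow (t : nat -> R) (w : nat -> C) (N : nat) :
  Cprod (fun n => Rcpow (t n) (w n)) N =
  Cexp (sum_n_m (fun n => Re (w n) * ln (t n)) 1 N,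
        sum_n_m (fun n => Im (w n) * ln (t n)) 1 N).
Proof.
  induction N as [|N IH]; simpl Cprod.
  - rewrite !sum_1_0; unfold Cexp; simpl.
    rewrite exp_0, cos_0, sin_0; unfold RtoC; f_equal; ring.
  - rewrite IH, !sum_1_S; unfold Rcpow; rewrite <- Cexp_plus; f_equal.
    unfold Cplus, Cmult, RtoC, Re, Im; simpl; f_equal; ring.
Qed.

Lemma filterlim_Cexp (x y : nat -> R) (a b : R) :
  is_lim_seq x a -> is_lim_seq y b ->
  filterlim (fun n => Cexp (x n, y n)) eventually (locally (Cexp (a, b))).
Proof.
  intros Hx Hy.
  assert (He : is_lim_seq (fun n => exp (x n)) (exp a)).
  { apply is_lim_seq_continuous; [apply derivable_continuous_pt, derivable_pt_exp | exact Hx]. }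
  assert (H1 : is_lim_seq (fun n => exp (x n) * cos (y n)) (exp a * cos b)).
  { apply is_lim_seq_mult'; [exact He|].
    apply is_lim_seq_continuous; [apply continuity_cos | exact Hy]. }
  assert (H2 : is_lim_seq (fun n => exp (x n) * sin (y n)) (exp a * sin b)).
  { apply is_lim_seq_mult'; [exact He|].
    apply is_lim_seq_continuous; [apply continuity_sin | exact Hy]. }
  intros P [eps HP].
  destruct (H1 _ (locally_ball _ eps)) as [N1 HN1].
  destruct (H2 _ (locally_ball _ eps)) as [N2 HN2].
  exists (Nat.max N1 N2); intros n Hn; apply HP.
  split; [apply HN1 | apply HN2]; lia.
Qed.

Theorem proposition7 :
  forall (k : nat) (chi : Z -> C) (beta : R),
    (0 < k)%nat ->
    (forall n : Z, chi (n + Z.of_nat k)%Z = chi n) ->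
    (forall n : Z, chi (- n)%Z = Copp (chi n)) ->
    0 < beta < 1 ->
    is_Cprod
      (fun n : nat =>
         Rcpow (1 - beta ^ 2 / INR n ^ 2)
               (RtoC (INR n) * chi (Z.of_nat n))%C)
      (Cexp
         (RtoC (- (PI / INR k)) *
          sum_n_m
            (fun j : nat =>
               chi (Z.of_nat j) *
               RtoC (RInt (fun x : R => (x * cot (PI * (x + INR j) / INR k))%R)
                          0 beta))%C
            1 (k - 1))%C).
Proof.
  intros k chi beta Hk Hper Hodd Hb.
  assert (HRe := is_lim_seq_sum_odd_ln k (fun n => Re (chi n)) beta Hk
    (fun n => f_equal Re (Hper n)) (fun n => f_equal Re (Hodd n)) Hb).
  assert (HIm := is_lim_seq_sum_odd_ln k (fun n => Im (chi n)) beta Hk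
    (fun n => f_equal Im (Hper n)) (fun n => f_equal Im (Hodd n)) Hb).
  assert (H := filterlim_Cexp _ _ _ _ HRe HIm).
  unfold is_Cprod.
  match goal with |- filterlim _ _ (locally (Cexp ?z)) =>
    match type of H with filterlim _ _ (locally (Cexp ?z')) => replace z with z' end end.
  - eapply filterlim_ext; [|exact H]; intros N; cbv beta.
    rewrite (Cprod_Rcpow (fun n => 1 - beta ^ 2 / INR n ^ 2)
      (fun n => RtoC (INR n) * chi (Z.of_nat n))%C).
    apply f_equal, f_equal2; apply sum_1_ext; intros n _; unfold Cmult, Re, Im, RtoC; simpl; ring.
  - match goal with |- _ = (_ * ?s)%C => set (z := s) end.
    assert (E : z = (Re z, Im z)) by (now destruct z).
    rewrite E; unfold z at 1 2; rewrite Re_sum_1, Im_sum_1; unfold Cmult, RtoC; simpl.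
    rewrite !Rmult_0_l, Rminus_0_r, Rplus_0_r.
    apply f_equal2; f_equal; apply sum_1_ext; intros j _; unfold Cmult, RtoC, Re, Im; ring.
Qed.
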